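(* Let $X$ be a continuum and $f:X\to X$ a homeomorphism such that $X\setminus\Omega(f)\neq\emptyset$. Then $h_{top}(2^f)=+\infty$.
   Context: A continuum is a non-empty compact connected metric space. A point $x\in X$ is wandering for $f$ if it has a neighborhood $U$ with $f^{-n}(U)\cap U=\emptyset$ for all $n\ge 1$; $\Omega(f)$ is the set of points that are not wandering. $2^X$ is the set of all non-empty compact subsets of $X$ with the Hausdorff metric, and $2^f:2^X\to 2^X$, $A\mapsto f(A)$. $h_{top}$ is the usual (Bowen–Dinaburg) topological entropy. *)

(* Defs.v *)
From HB Require Import structures.
From mathcomp Require Import all_boot all_order all_algebra finmap.
From mathcomp Require Import all_classical all_reals all_analysis.

Set Implicit Arguments.
Unset Strict Implicit.
Unset Printing Implicit Defensive.

Import Order.TTheory GRing.Theory Num.Theory.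
Import numFieldTopology.Exports numFieldNormedType.Exports.

Local Open Scope classical_set_scope.
Local Open Scope ring_scope.

Definition continuum (R : realType) (X : metricType R) : Prop :=
  [/\ [set: X] !=set0, compact [set: X] & connected [set: X]].

Definition homeomorphism (X Y : topologicalType) (f : X -> Y) : Prop :=
  continuous f /\
  exists g : Y -> X, [/\ cancel f g, cancel g f & continuous g].

Definition wandering (X : topologicalType) (f : X -> X) (x : X) : Prop :=
  exists2 U : set X, nbhs x U &
    forall n, (1 <= n)%N -> (iter n f @^-1` U) `&` U = set0.

Definition nonwandering_set (X : topologicalType) (f : X -> X) : set X :=
  [set x | ~ wandering f x].

Record hyperspace (X : topologicalType) := Hyperspace {
  hset :> set X ;
  hset_nonempty : hset !=set0 ;
  hset_compact : compact hset }.

Lemma hset_inj (X : topologicalType) : injective (@hset X).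
Proof.
case=> A A0 cA [B B0 cB] /= AB; rewrite -{}AB in B0 cB *.
by rewrite (Prop_irrelevance A0 B0) (Prop_irrelevance cA cB).
Qed.

HB.instance Definition _ (X : topologicalType) :=
  gen_eqMixin (hyperspace X).
HB.instance Definition _ (X : topologicalType) :=
  gen_choiceMixin (hyperspace X).

Definition thickening (R : realType) (X : metricType R) (A : set X) (e : R) :
  set X := [set x | exists2 a, A a & mdist a x < e].

Definition hausdorff_dist (R : realType) (X : metricType R) (A B : set X) : R :=
  inf [set e | [/\ 0 < e, A `<=` thickening B e & B `<=` thickening A e]].

Section hausdorff_metric.
Context {R : realType} {X : metricType R}.
Implicit Types (A B C : set X) (K L M : hyperspace X).

Let radii A B :=
  [set e : R | [/\ 0 < e, A `<=` thickening B e & B `<=` thickening A e]].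

Let radii_lb A B : has_lbound (radii A B).
Proof. by exists 0 => e [/ltW]. Qed.

Let compact_ball (x : X) A : compact A ->
  exists r : R, forall y, A y -> mdist x y < r.
Proof.
move/compact_near_coveringP => /(_ R +oo%R (fun r y => mdist x y < r)) [].
  move=> y _; exists (ball y 1, [set r | mdist x y + 1 < r]) => /=.
    split; first by apply: nbhsx_ballx; exact: ltr01.
    by apply: nbhs_pinfty_gt; exact: num_real.
  move=> [z r] /= []; rewrite ballEmdist /= => yz.
  apply: le_lt_trans; rewrite (le_trans (metric_triangle _ y _))//.
  by rewrite lerD2l ltW.
move=> M [_ Mlt]; exists (M + 1) => y Ay.
by apply: Mlt => //; rewrite ltrDl.
Qed.

Let radii0 K L : radii K L !=set0.
Proof.
have [[a Ka] [b Lb]] := (hset_nonempty K, hset_nonempty L).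
have [r Lr] := compact_ball a (@hset_compact _ L).
have [s Ks] := compact_ball b (@hset_compact _ K).
exists (Num.max r s); split.
- by rewrite lt_max (le_lt_trans (mdist_ge0 _ _) (Lr _ Lb)).
- by move=> y /Ks bs; exists b => //; rewrite lt_max bs orbT.
- by move=> y /Lr ar; exists a => //; rewrite lt_max ar.
Qed.

Let thickeningD A (d e : R) :
  thickening (thickening A d) e `<=` thickening A (d + e).
Proof.
move=> x [y [a Aa ay] yx]; exists a => //.
by rewrite (le_lt_trans (metric_triangle _ y _))// ltrD.
Qed.

Let thickeningS A B (e : R) :
  A `<=` B -> thickening A e `<=` thickening B e.
Proof. by move=> AB x [a /AB Ba ax]; exists a. Qed.

Let hausdorff_distxx K : hausdorff_dist K K = 0.
Proof.
have sub e : 0 < e -> (K : set X) `<=` thickening K e.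
  by move=> e0 x Kx; exists x => //; rewrite mdistxx.
apply/eqP; rewrite eq_le lb_le_inf ?andbT; last 2 first.
- exact: radii0.
- by move=> e [/ltW].
apply/ler_addgt0Pl => e e0; rewrite addr0.
by apply: ge_inf; [exact: radii_lb|split => //; exact: sub].
Qed.

Let hausdorff_dist_sym K L : hausdorff_dist K L = hausdorff_dist L K.
Proof.
by congr inf; apply/seteqP; split => e [].
Qed.

Let hausdorff_dist0_sub K L :
  hausdorff_dist K L = 0 -> (K : set X) `<=` (L : set X).
Proof.
move=> KL0 x Kx.
have := compact_closed (@metric_hausdorff _ _) (@hset_compact _ L).
apply => U /nbhs_ballP[e /= e0 xeU].
have [|r [_ KLr _]] := @inf_adherent _ (radii K L) e e0.
  by split; [exact: radii0|exact: radii_lb].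
rewrite -/(hausdorff_dist K L) KL0 add0r => re.
have [a La ax] := KLr _ Kx; exists a; split => //.
by apply: xeU; rewrite ballEmdist /= metric_sym (lt_trans ax).
Qed.

Let hausdorff_dist_eq0 K L : hausdorff_dist K L = 0 -> K = L.
Proof.
move=> KL0; apply: hset_inj; apply/seteqP; split.
  exact: hausdorff_dist0_sub.
by apply: hausdorff_dist0_sub; rewrite hausdorff_dist_sym.
Qed.

Let hausdorff_dist_triangle L K M :
  hausdorff_dist K M <= hausdorff_dist K L + hausdorff_dist L M.
Proof.
rewrite -lerBlDr; apply: lb_le_inf; first exact: radii0.
move=> d [d0 KL LK]; rewrite lerBlDr -lerBlDl.
apply: lb_le_inf; first exact: radii0.
move=> e [e0 LM ML]; rewrite lerBlDl.
apply: ge_inf; first exact: radii_lb.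
split; first exact: addr_gt0.
- rewrite addrC; apply: subset_trans (@thickeningD _ _ _).
  by apply: (subset_trans KL); exact: thickeningS.
- apply: subset_trans (@thickeningD _ _ _).
  by apply: (subset_trans ML); exact: thickeningS.
Qed.

HB.instance Definition _ := isMetric.Build R (hyperspace X)
  hausdorff_distxx hausdorff_dist_eq0 hausdorff_dist_sym
  hausdorff_dist_triangle.

End hausdorff_metric.

Lemma hyper_map_nonempty (X Y : topologicalType) (f : continuousType X Y)
  (K : hyperspace X) : f @` K !=set0.
Proof. by have [x Kx] := hset_nonempty K; exists (f x), x. Qed.

Lemma hyper_map_compact (X Y : topologicalType) (f : continuousType X Y)
  (K : hyperspace X) : compact (f @` K).
Proof.
apply: continuous_compact; last exact: hset_compact.
exact/continuous_subspaceT/cts_fun.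
Qed.

Definition hyper_map (X Y : topologicalType) (f : continuousType X Y)
    (K : hyperspace X) : hyperspace Y :=
  Hyperspace (hyper_map_nonempty f K) (@hyper_map_compact X Y f K).

Section entropy.
Context {R : realType} {T : metricType R}.
Implicit Types (f : T -> T) (n : nat) (e : R).

Definition bowen_dist f n (x y : T) : R :=
  \big[Num.max/0]_(i < n) mdist (iter i f x) (iter i f y).

Definition bowen_separated f n e (E : {fset T}) : Prop :=
  forall x y, x \in E -> y \in E -> x != y -> e < bowen_dist f n x y.

(* Taken in \bar R because T is not assumed compact. *)
Definition separated_number f n e : \bar R :=
  ereal_sup [set (#|` E|%:R)%:E | E in bowen_separated f n e].

(* The term n = 0, where n%:R^-1 = 0, does not affect the limsup. *)
Definition scale_entropy f e : \bar R :=
  limn_esup (fun n => (n%:R^-1)%:E * lne (separated_number f n e))%E.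

Lemma is_cvg_scale_entropy f : cvg (scale_entropy f e @[e --> 0^'+]).
Proof.
apply: nonincreasing_at_right_is_cvge; near=> e0 => d e _ _ de.
have sN n c : (0 <= separated_number f n c)%E.
  by apply: ereal_sup_ubound; exists fset0 => //=; rewrite cardfs0.
rewrite /scale_entropy /limn_esup /limf_esup.
apply: le_ereal_inf_tmp => _ [V Voo <-].
apply: ge_ereal_inf.
exists (ereal_sup
  [set ((n%:R^-1)%:E * lne (separated_number f n e))%E | n in V]).
  by exists V.
apply: ge_ereal_sup => _ [n Vn <-].
apply: (@le_trans _ _ ((n%:R^-1)%:E * lne (separated_number f n d))%E);
  last first.
  by apply: ereal_sup_ubound; exists n.
apply: lee_wpmul2l; first by rewrite lee_fin invr_ge0.
rewrite lee_lne ?in_itv /= ?sN ?leey//.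
apply: le_ereal_sup => _ [E sE <-]; exists E => //.
by move=> x y xE yE xy; rewrite (le_lt_trans de)// sE.
Unshelve. all: by end_near. Qed.

Definition topological_entropy f : \bar R :=
  lim (scale_entropy f e @[e --> 0^'+]).

End entropy.

(* Main.v *)
(* Let U be a ball around a wandering point x with f^n(U) disjoint from U for
   all n <> 0. As X is connected, for every k there are points y_0, ..., y_(k-1)
   of U that are pairwise e apart and whose e-balls lie in U: take d(x, y_j) =
   j e. A set S of pairs (i, j) with i < n, j < k is coded by the finite set
   A_S = {f(x)} U {f^(-i)(y_j) : (i, j) in S}. Since f^i(A_S) meets U exactly in
   the y_j with (i, j) in S, the codes are (n, e)-separated for 2^f; there are
   2^(kn) of them, so the entropy is at least k ln 2, for every k. *)

Require Import Defs.
From mathcomp Require Import all_boot all_order all_algebra finmap.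
From mathcomp Require Import all_classical all_reals all_analysis.

Set Implicit Arguments.
Unset Strict Implicit.

Local Open Scope classical_set_scope.
Local Open Scope ring_scope.

Import Order.TTheory GRing.Theory Num.Theory.
Import numFieldTopology.Exports numFieldNormedType.Exports.

(** * Distances to a point and lower bounds for the Hausdorff distance *)

Lemma dist_mdist_le (R : realType) (X : metricType R) (x y z : X) :
  `|mdist x y - mdist x z| <= mdist y z.
Proof.
rewrite ler_distl lerBlDr metric_triangle /= [mdist y z]metric_sym.
exact: metric_triangle.
Qed.

Lemma mdist_continuous (R : realType) (X : metricType R) (x : X) :
  continuous (mdist x : X -> R).
Proof.
move=> y; apply/cvgrPdist_lt => e e0; near=> z.
apply: le_lt_trans (dist_mdist_le _ _ _) _.
have : ball y e z by near: z; exact: nbhsx_ballx.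
by rewrite ballEmdist.
Unshelve. all: by end_near. Qed.

(** The distances to [x] form a connected subset of the line, hence an interval, and it contains
    0. *)
Lemma connected_mdist_ivt (R : realType) (X : metricType R) (x y : X) (r : R) :
  connected [set: X] -> 0 <= r <= mdist x y -> exists z, mdist x z = r.
Proof.
move=> cX r01.
have /connected_intervalP itv : connected (range (mdist x : X -> R)).
  apply: connected_continuous_connected cX _.
  exact/continuous_subspaceT/mdist_continuous.
have [z _ zr] : range (mdist x : X -> R) r; last by exists z.
apply: (itv 0 (mdist x y)) r01; last by exists y.
by exists x => //; rewrite mdistxx.
Qed.

Lemma compact_mdist_bounded (R : realType) (X : metricType R) (A : set X)
  (x : X) : compact A -> exists r : R, forall y, A y -> mdist x y < r.
Proof.
move=> cA.
have /compact_bounded[M [_ /(_ (M + 1))]] : compact (mdist x @` A : set R).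
  apply: continuous_compact cA.
  exact/continuous_subspaceT/mdist_continuous.
rewrite ltrDl ltr01 => /(_ isT) AM; exists (M + 2) => y Ay.
apply: le_lt_trans (le_trans (ler_norm _) (AM _ (imageP _ Ay))) _.
by rewrite ltrD2l ltr1n.
Qed.

Lemma hausdorff_dist_ge (R : realType) (X : metricType R)
    (K L : hyperspace X) (x : X) (e : R) :
  hset K x -> (forall y, hset L y -> e <= mdist y x) -> e <= hausdorff_dist K L.
Proof.
move=> Kx Le; apply: lb_le_inf; last first.
  by move=> r [_ /(_ _ Kx)[y /Le ey yx] _]; rewrite (le_trans ey)// ltW.
(* Bounding the infimum from below also requires some admissible radius; compactness of both sets
   supplies one. *)
have [z Lz] := hset_nonempty L.
have [r Lr] := @compact_mdist_bounded _ _ _ x (@hset_compact _ L).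
have [s Ks] := @compact_mdist_bounded _ _ _ z (@hset_compact _ K).
exists (Num.max r s); split => [|y /Ks zs|y /Lr xr].
- by rewrite lt_max (le_lt_trans (mdist_ge0 _ _) (Lr _ Lz)).
- by exists z => //; rewrite lt_max zs orbT.
- by exists x => //; rewrite lt_max xr.
Qed.

Lemma hyper_map_iter (X : topologicalType) (f : continuousType X X) (n : nat)
  (K : hyperspace X) :
  (iter n (hyper_map f) K : set X) = iter n f @` K.
Proof.
elim: n => [|n IH] /=; first by rewrite image_id.
by rewrite IH image_comp.
Qed.

(** * Entropy bounds from separated families *)

Lemma bowen_dist_sym (R : realType) (T : metricType R) (f : T -> T) (n : nat)
  (x y : T) : bowen_dist f n x y = bowen_dist f n y x.
Proof. by apply: eq_bigr => i _; rewrite metric_sym. Qed.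

Lemma bowen_dist_xx (R : realType) (T : metricType R) (f : T -> T) (n : nat)
  (x : T) : bowen_dist f n x x = 0.
Proof.
rewrite /bowen_dist (eq_bigr (fun=> 0)) => [|i _]; last exact: mdistxx.
by apply: big1_idem => //; exact: maxxx.
Qed.

(** A separated family is injective, as the Bowen distance vanishes on the diagonal and [e] is
    non-negative. *)
Lemma card_le_separated_number (R : realType) (T : metricType R) (f : T -> T)
    (n : nat) (e : R) (I : finType) (F : I -> T) :
  0 <= e -> (forall i j, i != j -> e < bowen_dist f n (F i) (F j)) ->
  (#|I|%:R%:E <= separated_number f n e)%E.
Proof.
move=> e0 sepF; apply: ereal_sup_ubound.
exists [fset F i | i in I]%fset.
  move=> _ _ /imfsetP[i _ ->] /imfsetP[j _ ->] Fij; apply: sepF.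
  by apply: contra_neq Fij => ->.
rewrite card_imfset ?cardE//=.
move=> i j Fij; apply/eqP; apply: contraT => /sepF.
by rewrite Fij bowen_dist_xx ltNge e0.
Qed.

Lemma ln_le_scale_entropy (R : realType) (T : metricType R) (f : T -> T)
    (e a : R) :
  0 < a -> (forall n, (0 < n)%N -> ((a ^+ n)%:E <= separated_number f n e)%E) ->
  ((ln a)%:E <= scale_entropy f e)%E.
Proof.
move=> a0 afn; apply: le_ereal_inf_tmp => _ [V [N _ NV] <-].
(* A single index of [V] bounds the supremum over [V]; the successor makes it positive, so that
   [n%:R] can be cancelled. *)
pose n := N.+1.
apply: (@le_trans _ _ ((n%:R^-1)%:E * lne (separated_number f n e))%E);
  last first.
  by apply: ereal_sup_ubound; exists n => //; apply: NV; rewrite /= leqnSn.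
have -> : (ln a)%:E = ((n%:R^-1)%:E * lne (a ^+ n)%:E)%E.
  rewrite lne_EFin ?exprn_gt0// lnXn// -EFinM -[ln a *+ n]mulr_natl.
  by rewrite mulKf// pnatr_eq0.
apply: lee_wpmul2l; first by rewrite lee_fin invr_ge0.
have an0 : (0 <= (a ^+ n)%:E)%E by rewrite lee_fin exprn_ge0// ltW.
rewrite lee_lne ?in_itv /= ?an0 ?leey ?(le_trans an0)//; exact: afn.
Qed.

Lemma iter_cancel_sub (T : Type) (f g : T -> T) (m n : nat) (x : T) :
  cancel g f -> (n <= m)%N -> iter m f (iter n g x) = iter (m - n) f x.
Proof.
move=> gK; elim: n m => [|n IH] [|m]//= nm; rewrite ?subn0//.
by rewrite -iterS iterSr gK IH.
Qed.

(** * Coding sets of pairs by finite pieces of wandering orbits *)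

Section wandering_separation.
Context {R : realType} {X : metricType R} (f : continuousType X X).
Context (g : X -> X) (gK : cancel g f).
Context (U : set X) (k : nat) (y : 'I_k -> X) (p : X) (e : R).
Hypothesis fU : forall n x, U x -> (0 < n)%N -> ~ U (iter n f x).
Hypothesis pU : forall n, ~ U (iter n f p).
Hypothesis y_dist : forall i j, i != j -> e <= mdist (y i) (y j).
Hypothesis y_ball : forall i x, mdist (y i) x < e -> U x.
Hypothesis e0 : 0 < e.

Let gU n x : U x -> (0 < n)%N -> ~ U (iter n g x).
Proof.
move=> Ux n0 /(@fU n) /(_ n0).
by rewrite iter_cancel_sub// subnn.
Qed.

Let yU i : U (y i). Proof. by apply: (@y_ball i); rewrite mdistxx. Qed.

(* The point [p] only keeps the set non-empty when [S] is empty. *)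
Definition orbit_code (n : nat) (S : {set 'I_n * 'I_k}) : set X :=
  p |` [set iter q.1 g (y q.2) | q in [set` S]].

Let orbit_code_nonempty n (S : {set 'I_n * 'I_k}) : orbit_code S !=set0.
Proof. by exists p; left. Qed.

Let orbit_code_compact n (S : {set 'I_n * 'I_k}) : compact (orbit_code S).
Proof.
apply: finite_compact; rewrite finite_setU; split => //.
exact/finite_image/finite_finset.
Qed.

Let code n (S : {set 'I_n * 'I_k}) : hyperspace X :=
  Hyperspace (orbit_code_nonempty S) (@orbit_code_compact n S).

(** At time [q.1] the image of [code S] contains [y q.2], while each point of the image of [code T]
    is outside [U] or is another [y j]. *)
Let code_bowen_dist n (S T : {set 'I_n * 'I_k}) q :
  q \in S -> q \notin T -> e <= bowen_dist (hyper_map f) n (code S) (code T).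
Proof.
move=> qS qT.
apply: le_trans (le_bigmax _ _ q.1).
apply: (@hausdorff_dist_ge _ _ _ _ (y q.2)).
  rewrite hyper_map_iter; exists (iter q.1 g (y q.2)).
    by right; exists q.
  by rewrite iter_cancel_sub// subnn.
have far w : ~ U w -> e <= mdist w (y q.2).
  move=> nUw; rewrite leNgt; apply/negP.
  by rewrite metric_sym => /y_ball.
move=> z; rewrite hyper_map_iter => -[_ [->|[q' /= q'T <-]] <-].
  exact/far/pU.
(* At time [q.1] the point coded by [q'] has already left [U], has not yet reached it, or is exactly
   at [y q'.2]. *)
have [lt|lt|eq] := ltngtP q'.1 q.1.
- rewrite iter_cancel_sub ?(ltnW lt)//.
  by apply/far/fU; rewrite ?subn_gt0.
- rewrite -(subnKC (ltnW lt)) iterD iter_cancel_sub// subnn /=.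
  by apply/far/gU; rewrite ?subn_gt0.
- rewrite -eq iter_cancel_sub// subnn /= y_dist//.
  apply: contraNneq qT => q2; suff -> : q = q' by [].
  by rewrite [q]surjective_pairing [q']surjective_pairing q2 (ord_inj eq).
Qed.

Lemma wandering_separated_number n d : 0 <= d < e ->
  (((2 ^+ k) ^+ n)%:E <= separated_number (hyper_map f) n d)%E.
Proof.
move=> /andP[d0 de].
have -> : (2 ^+ k) ^+ n = #|{set 'I_n * 'I_k}|%:R :> R.
  rewrite -cardsT -powersetT card_powerset cardsT card_prod !card_ord.
  by rewrite natrX mulnC exprM.
apply: (@card_le_separated_number _ _ _ _ _ _ (@code n)) => // S T ST.
(* The codes are only known to be at least [e] apart; [d < e] gives strict separation. *)
apply: (lt_le_trans de).
have [/fintype.subsetP sST|/fintype.subsetPn[q qS qT]] := boolP (S \subset T);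
  last exact: code_bowen_dist qS qT.
have : ~~ (T \subset S).
  apply: contraNN ST => TS; rewrite finset.eqEsubset TS andbT.
  exact/fintype.subsetP.
move=> /fintype.subsetPn[q qT qS].
by rewrite bowen_dist_sym; exact: code_bowen_dist qT qS.
Qed.

End wandering_separation.

Theorem corollary3p3 (R : realType) (X : metricType R)
    (f : continuousType X X)
    (hX : continuum X)
    (hf : homeomorphism f)
    (hw : [set: X] `\` nonwandering_set f !=set0) :
  topological_entropy (hyper_map f) = +oo%E.
Proof.
have [_ _ cX] := hX; have [_ [g [_ gK _]]] := hf.
have [x [_ /contrapT[U /nbhs_ballP[d /= d0 xdU] fU]]] := hw.
have {}fU n z : U z -> (0 < n)%N -> ~ U (iter n f z).
  move=> Uz n0 fUz; have : (iter n f @^-1` U `&` U) z by [].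
  by rewrite fU.
have Ux : U x by apply: xdU; exact: ballxx.
(* The point [f x] lies outside [U], so all distances up to [d] from [x] are attained. *)
have dfx : d <= mdist x (f x).
  rewrite leNgt; apply/negP => fxd; apply: (@fU 1%N x) => //.
  by apply: xdU; rewrite ballEmdist.
apply/eqyP => A A0.
pose k := (Num.truncn (A / ln 2)).+1.
have ln20 : 0 < ln (2 : R) by rewrite ln_gt0// ltr1n.
have Ak : A <= ln (2 ^+ k : R).
  by rewrite lnXn// -(mulr_natl _ k) -ler_pdivrMr// ltW// truncnS_gt.
(* With this step the [e]-balls around points at distances 0, [e], ..., [(k-1)e] from [x] stay in
   the [d]-ball. *)
pose e : R := d / k%:R.
have e0 : 0 < e by rewrite divr_gt0.
have dE : d = e *+ k by rewrite -[RHS]mulr_natr divfK ?pnatr_eq0.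
have /choice[y yE] : forall j : 'I_k, exists z, mdist x z = e *+ j.
  move=> j; apply: connected_mdist_ivt (f x) _ cX _.
  rewrite mulrn_wge0 ?(ltW e0)//= (le_trans _ dfx)// dE.
  by rewrite ler_pMn2l// ltnW.
(* It suffices to bound the entropy at all small scales [c], here those below [e]. *)
apply: lime_ge; first exact: is_cvg_scale_entropy.
near=> c.
apply: (@le_trans _ _ (ln (2 ^+ k))%:E); first by rewrite lee_fin.
apply: ln_le_scale_entropy => [|n n0]; first exact: exprn_gt0.
apply: (wandering_separated_number (U := U) (y := y) (p := f x) (e := e) gK) => //.
- by move=> m; rewrite -iterSr; apply: fU.
(* The points are separated because their distances to [x] differ by a non-zero multiple of [e]. *)
- move=> i j ij; apply: le_trans (dist_mdist_le x _ _); rewrite !yE.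
  wlog ij' : i j ij / (i < j)%N.
    move=> H; have [ij'|ji|/val_inj eq] := ltngtP i j; first exact: H.
    - by rewrite distrC; apply: H; rewrite // eq_sym.
    - by rewrite eq eqxx in ij.
  rewrite distrC -mulrnBr ?(ltnW ij')// ger0_norm ?mulrn_wge0 ?(ltW e0)//.
  by rewrite -[leLHS]mulr1n ler_pMn2l// subn_gt0.
- move=> i z yz; apply: xdU; rewrite ballEmdist /= dE.
  apply: le_lt_trans (metric_triangle _ (y i) _) _; rewrite yE.
  apply: (@lt_le_trans _ _ (e *+ i.+1)); first by rewrite mulrSr ltrD2l.
  by rewrite ler_pMn2l// ltn_ord.
- apply/andP; split; near: c; [exact: nbhs_right_ge|exact: nbhs_right_lt].
Unshelve. all: by end_near. Qed.
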